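(* For each $n\in\{3,4,6,8\}$ there exists exactly one common meadow of order $n$ (i.e. with exactly $n$ elements), up to isomorphism.
   Context: A pre-meadow is a structure $(P,+,-,\cdot)$ with two binary operations $+,\cdot$, a unary operation $-$ and constants $0,1$, satisfying for all $x,y,z\in P$: $(x+y)+z=x+(y+z)$; $x+y=y+x$; $x+0=x$; $x+(-x)=0\cdot x$; $(x\cdot y)\cdot z=x\cdot(y\cdot z)$; $x\cdot y=y\cdot x$; $1\cdot x=x$; $x\cdot(y+z)=x\cdot y+x\cdot z$; $-(-x)=x$; $0\cdot(x+y)=0\cdot x+0\cdot y$. For a pre-meadow $P$, let $0\cdot P=\{0\cdot x\mid x\in P\}$ and, for $z\in 0\cdot P$, let $P_z=\{x\in P\mid 0\cdot x=z\}$. $P$ is a pre-meadow with $\mathbf{a}$ if there exists a unique $z\in 0\cdot P$ with $|P_z|=1$, this $z$ being denoted $\mathbf{a}$, and moreover $x+\mathbf{a}=\mathbf{a}$ for all $x\in P$. A common meadow is a pre-meadow with $\mathbf{a}$, $M$, equipped with a (total) inverse function $(\cdot)^{-1}:M\to M$ such that for all $x,y\in M$: $x\cdot x^{-1}=1+0\cdot x^{-1}$; $(x\cdot y)^{-1}=x^{-1}\cdot y^{-1}$; $(1+0\cdot x)^{-1}=1+0\cdot x$; $0^{-1}=\mathbf{a}$. An isomorphism of common meadows is a bijection preserving $0$, $1$, $+$, $\cdot$, $-$ and $(\cdot)^{-1}$. *)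

(* Defs.v *)
From mathcomp Require Import all_boot.

Set Implicit Arguments.
Unset Strict Implicit.
Unset Printing Implicit Defensive.

Declare Scope meadow_scope.
Delimit Scope meadow_scope with M.

(* The ring structures of MathComp do not apply: neither [0 * x = 0] nor
   [x + (- x) = 0] holds in a pre-meadow. *)
Record preMeadow := PreMeadow {
  pm_sort :> Type;
  pm_zero : pm_sort;
  pm_one : pm_sort;
  pm_add : pm_sort -> pm_sort -> pm_sort;
  pm_opp : pm_sort -> pm_sort;
  pm_mul : pm_sort -> pm_sort -> pm_sort;
  pm_addA : forall x y z, pm_add (pm_add x y) z = pm_add x (pm_add y z);
  pm_addC : forall x y, pm_add x y = pm_add y x;
  pm_addx0 : forall x, pm_add x pm_zero = x;
  pm_addxN : forall x, pm_add x (pm_opp x) = pm_mul pm_zero x;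
  pm_mulA : forall x y z, pm_mul (pm_mul x y) z = pm_mul x (pm_mul y z);
  pm_mulC : forall x y, pm_mul x y = pm_mul y x;
  pm_mul1x : forall x, pm_mul pm_one x = x;
  pm_mulDr : forall x y z,
    pm_mul x (pm_add y z) = pm_add (pm_mul x y) (pm_mul x z);
  pm_oppK : forall x, pm_opp (pm_opp x) = x;
  pm_mul0D : forall x y,
    pm_mul pm_zero (pm_add x y) = pm_add (pm_mul pm_zero x) (pm_mul pm_zero y)
}.

Arguments pm_zero {p}.
Arguments pm_one {p}.

Notation "0" := pm_zero : meadow_scope.
Notation "1" := pm_one : meadow_scope.
Notation "x + y" := (pm_add x y) : meadow_scope.
Notation "- x" := (pm_opp x) : meadow_scope.
Notation "x * y" := (pm_mul x y) : meadow_scope.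

Local Open Scope meadow_scope.

Definition zero_mul_set (P : preMeadow) (z : P) : Prop :=
  exists x : P, 0 * x = z.

Definition zero_fiber (P : preMeadow) (z x : P) : Prop := 0 * x = z.

Definition singleton_fiber (P : preMeadow) (z : P) : Prop :=
  zero_mul_set z /\ exists! x : P, zero_fiber z x.

(* The element [a] is a field only to give it a name: [cm_aP] determines it. *)
Record commonMeadow := CommonMeadow {
  cm_base :> preMeadow;
  cm_a : cm_base;
  cm_aP : unique (@singleton_fiber cm_base) cm_a;
  cm_addxa : forall x : cm_base, x + cm_a = cm_a;
  cm_inv : cm_base -> cm_base;
  cm_mulxV : forall x, x * cm_inv x = 1 + 0 * cm_inv x;
  cm_invM : forall x y, cm_inv (x * y) = cm_inv x * cm_inv y;
  cm_inv1D0 : forall x, cm_inv (1 + 0 * x) = 1 + 0 * x;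
  cm_inv0 : cm_inv 0 = cm_a
}.

Definition has_order (n : nat) (T : Type) : Prop :=
  exists f : 'I_n -> T, bijective f.

Definition meadow_isomorphism (M N : commonMeadow) (f : M -> N) : Prop :=
  bijective f /\
  [/\ f 0 = 0,
      f 1 = 1,
      forall x y, f (x + y) = f x + f y,
      forall x y, f (x * y) = f x * f y &
      forall x, f (- x) = - f x] /\
  (forall x, f (cm_inv x) = cm_inv (f x)).

Definition meadow_isomorphic (M N : commonMeadow) : Prop :=
  exists f : M -> N, meadow_isomorphism f.

(* Main.v *)
Require Import Defs.
From mathcomp Require Import all_boot.
From mathcomp Require Import all_fingroup all_algebra all_solvable.

Set Implicit Arguments.
Unset Strict Implicit.
Unset Printing Implicit Defensive.

Import GRing.Theory.

(** The orders in the theorem are [p + 1] with [p] one of the primes 2, 3, 5, 7,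
and the common meadow in question is the prime field ['F_p] with an absorbing
element added: the inverse of zero.

Uniqueness. Let [N] be a common meadow with [p + 1] elements, and consider the
translation [s : x |-> x + 1], a permutation of [N] as [1] can be cancelled.
- The element [a] is fixed by [s], and it is the only fixed point: if
  [x + 1 = x], then one is zero in the ring of all [y] with [0 * y = 0 * x], so
  that this ring is trivial, and only the fiber of [a] is a singleton
  ([add1_fixed_eq_a]).
- If [s ^ k] fixes [0], then the numeral [k] is zero and [s ^ k] is the
  identity. Hence the orbit of [0], the set of numerals, has as many elements
  as the order [c] of [s], and [c <= p].
- If [c < p], then some element is neither [a] nor a numeral. It is moved by
  [s], so there are two such elements and [c <= p - 2 <= 5]; thus [c] is a power
  of a prime [q]. A permutation whose order is a power of [q] moves a multiple
  of [q] points. Here it moves [p] points, so that [q = p] and [c >= p], a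
  contradiction ([perm_order_prime]).
So [c = p], and [N] consists of [a] and the numerals modulo [p]. All operations
of [N] are then forced, and [N] is isomorphic to ['F_p] with [a] added
([numeral_isomorphism]).

The bound on [p] enters only to make [c] a prime power. For [p = 11] the
conclusion fails: [c = 6] is possible, with rings of orders 3 and 2, incomparable
to each other, above one of order 6 and below the one-element ring. *)

(** * A field with an absorbing element *)

Local Open Scope ring_scope.

Definition ext_add (F : fieldType) (x y : option F) : option F :=
  if x is Some x' then if y is Some y' then Some (x' + y') else None else None.

Definition ext_mul (F : fieldType) (x y : option F) : option F :=
  if x is Some x' then if y is Some y' then Some (x' * y') else None else None.

Definition ext_opp (F : fieldType) (x : option F) : option F :=
  if x is Some x' then Some (- x') else None.

Definition ext_inv (F : fieldType) (x : option F) : option F :=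
  if x is Some x' then if x' == 0 then None else Some x'^-1 else None.

Definition ext_preMeadow (F : fieldType) : preMeadow.
Proof.
refine (@PreMeadow (option F) (Some 0) (Some 1) (@ext_add F) (@ext_opp F)
  (@ext_mul F) _ _ _ _ _ _ _ _ _ _).
- by move=> [x|] [y|] [z|] //=; rewrite addrA.
- by move=> [x|] [y|] //=; rewrite addrC.
- by move=> [x|] //=; rewrite addr0.
- by move=> [x|] //=; rewrite subrr mul0r.
- by move=> [x|] [y|] [z|] //=; rewrite mulrA.
- by move=> [x|] [y|] //=; rewrite mulrC.
- by move=> [x|] //=; rewrite mul1r.
- by move=> [x|] [y|] [z|] //=; rewrite mulrDr.
- by move=> [x|] //=; rewrite opprK.
- by move=> [x|] [y|] //=; rewrite mulrDr.
Defined.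

Lemma ext_unique_singleton (F : fieldType) :
  unique (@singleton_fiber (ext_preMeadow F)) None.
Proof.
split.
  split; first by exists None.
  by exists None; split=> // -[x|] //; rewrite /zero_fiber.
move=> [z|] // [[[x|] //= [zE]] [y [_ yU]]].
have z0 : z = 0 by rewrite -zE mul0r.
(* Two elements of this fiber are zero and one, which differ in a field. *)
have y0 : y = Some 0 by apply: yU; rewrite /zero_fiber /= mul0r z0.
have y1 : y = Some 1 by apply: yU; rewrite /zero_fiber /= mul0r z0.
by move: y1; rewrite y0 => -[/esym/eqP]; rewrite oner_eq0.
Qed.

Definition ext_meadow (F : fieldType) : commonMeadow.
Proof.
refine (@CommonMeadow (ext_preMeadow F) None (@ext_unique_singleton F) _
  (@ext_inv F) _ _ _ _).
- by move=> [x|].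
- move=> [x|] //=; case: (eqVneq x 0) => [//|x0] /=.
  by rewrite divff // mul0r addr0.
- move=> [x|] [y|] //=; last by case: ifP.
  rewrite mulf_eq0; case: (x == 0) => //=; case: (y == 0) => //=.
  by rewrite invfM.
- by move=> [x|] //=; rewrite mul0r addr0 oner_eq0 invr1.
- by rewrite /= eqxx.
Defined.

Local Close Scope ring_scope.
Local Open Scope meadow_scope.

(** * Identities in a common meadow *)

Lemma mulx1 (P : preMeadow) (x : P) : x * 1 = x.
Proof. by rewrite pm_mulC pm_mul1x. Qed.

Lemma add0x (P : preMeadow) (x : P) : 0 + x = x.
Proof. by rewrite pm_addC pm_addx0. Qed.

Lemma mul0N (P : preMeadow) (x : P) : 0 * - x = 0 * x.
Proof. by rewrite -(pm_addxN (- x)) pm_oppK pm_addC pm_addxN. Qed.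

Lemma mul00 (P : preMeadow) : 0 * 0 = 0 :> P.
Proof.
have /(congr1 (pm_mul 0)) := pm_addxN (1 : P).
by rewrite pm_mul0D mul0N mulx1 pm_addx0.
Qed.

Lemma mul0_idem (P : preMeadow) (x : P) : 0 * (0 * x) = 0 * x.
Proof. by rewrite -pm_mulA mul00. Qed.

Lemma mul0_add_idem (P : preMeadow) (x : P) : 0 * x + 0 * x = 0 * x.
Proof. by rewrite !(pm_mulC 0) -pm_mulDr pm_addx0. Qed.

Lemma mul0CA (P : preMeadow) (x y : P) : x * (0 * y) = 0 * (x * y).
Proof. by rewrite -!pm_mulA (pm_mulC x). Qed.

Lemma mul0_1D (P : preMeadow) (x : P) : 0 * (1 + x) = 0 * x.
Proof. by rewrite pm_mul0D mulx1 add0x. Qed.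

(** Multiply [0 * (1 + y) = 0 * y] by [x]. *)
Lemma mul0_absorb (P : preMeadow) (x y : P) :
  0 * x + 0 * (x * y) = 0 * (x * y).
Proof. by rewrite -pm_mul0D -{1}(mulx1 x) -pm_mulDr -!mul0CA mul0_1D. Qed.

(** In a pre-meadow this may fail; it holds here because [1 + 0 * x] is its
own inverse. *)
Lemma mul0_sqr (N : commonMeadow) (x : N) : 0 * (x * x) = 0 * x.
Proof.
pose t := 1 + 0 * x; have t0 : 0 * t = 0 * x by rewrite mul0_1D mul0_idem.
have <- : 0 * (t * t) = 0 * x.
  by rewrite -{2}[t]cm_inv1D0 cm_mulxV cm_inv1D0 mul0_1D mul0_idem.
rewrite {2}/t pm_mulDr mulx1 pm_mul0D t0 [t * _]pm_mulC {1}/t pm_mulDr mulx1.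
rewrite pm_mul0D mul0_idem mul0CA mul0_idem [0 * x * x]pm_mulA mul0_idem.
by rewrite !mul0_absorb.
Qed.

(** Expand [0 * ((x + y) * (x + y))], where the two squares are absorbed. *)
Lemma mul0_add_mul (N : commonMeadow) (x y : N) : 0 * (x + y) = 0 * (x * y).
Proof.
rewrite -mul0_sqr pm_mulDr ![(x + y) * _]pm_mulC !pm_mulDr.
by rewrite mul0_sqr mul0_absorb [x * y]pm_mulC [_ + 0 * (y * y)]pm_addC mul0_sqr
  mul0_absorb mul0_add_idem.
Qed.

Lemma mul0_a (N : commonMeadow) : 0 * cm_a N = cm_a N.
Proof. by have [[[x <-] _] _] := cm_aP N; rewrite mul0_idem. Qed.

Lemma fiber_a (N : commonMeadow) (x : N) : 0 * x = cm_a N -> x = cm_a N.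
Proof.
have [[_ [y [_ yU]]] _] := cm_aP N => xa.
by rewrite -(yU _ xa) (yU _ (mul0_a N)).
Qed.

Lemma mulxa (N : commonMeadow) (x : N) : x * cm_a N = cm_a N.
Proof. by apply: fiber_a; rewrite -mul0_add_mul cm_addxa mul0_a. Qed.

Lemma oppa (N : commonMeadow) : - cm_a N = cm_a N.
Proof. by apply: fiber_a; rewrite mul0N mul0_a. Qed.

Lemma inv1 (N : commonMeadow) : cm_inv (1 : N) = 1.
Proof. by have := cm_inv1D0 (0 : N); rewrite mul00 pm_addx0. Qed.

Lemma inva (N : commonMeadow) : cm_inv (cm_a N) = cm_a N.
Proof.
have := cm_mulxV (cm_a N).
rewrite pm_mulC mulxa => /(congr1 (pm_mul 0)); rewrite mul0_1D mul0_idem mul0_a.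
by move=> /esym /fiber_a.
Qed.

Lemma add1_inj (P : preMeadow) (x y : P) : x + 1 = y + 1 -> x = y.
Proof.
move=> /(congr1 (fun z => z + pm_opp 1)).
by rewrite !pm_addA pm_addxN mulx1 !pm_addx0.
Qed.

(** If [x + 1 = x], then [1 + 0 * x = 0 * x]; as [1 + 0 * x] is the unit of the
ring of all [y] with [0 * y = 0 * x], this ring is trivial. *)
Lemma add1_fixed_eq_a (N : commonMeadow) (x : N) : x + 1 = x -> x = cm_a N.
Proof.
move=> x1; have unit0 : 1 + 0 * x = 0 * x.
  by rewrite -pm_addxN -{3}x1 [x + 1]pm_addC pm_addA.
have triv y : 0 * y = 0 * x -> y = 0 * x.
  move=> yx; have y0x : y * (0 * x) = 0 * x.
    by rewrite mul0CA -mul0_add_mul pm_mul0D yx mul0_add_idem.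
  have yE : y = y + 0 * y.
    by rewrite (pm_mulC 0) -{2}(mulx1 y) -pm_mulDr pm_addx0 mulx1.
  by rewrite yE yx -{1}(mulx1 y) -{1}y0x -pm_mulDr unit0.
apply: fiber_a; apply/esym; apply: (proj2 (cm_aP N)).
split; first by exists x.
by exists (0 * x); split=> [|y yx]; [exact: mul0_idem | rewrite (triv y yx)].
Qed.

(** * Numerals *)

Fixpoint numeral (P : preMeadow) (k : nat) : P :=
  if k is k'.+1 then numeral P k' + 1 else 0.

Lemma numeralD (P : preMeadow) (k l : nat) :
  numeral P (k + l)%N = numeral P k + numeral P l.
Proof.
elim: l => [|l IH]; first by rewrite addn0 pm_addx0.
by rewrite addnS /= IH pm_addA.
Qed.

Lemma mul0_numeral (P : preMeadow) (k : nat) : 0 * numeral P k = 0.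
Proof.
by elim: k => [|k IH] /=; rewrite ?mul00 // pm_mul0D IH mulx1 pm_addx0.
Qed.

Lemma numeralM (P : preMeadow) (k l : nat) :
  numeral P (k * l)%N = numeral P k * numeral P l.
Proof.
elim: l => [|l IH]; first by rewrite muln0 /= pm_mulC mul0_numeral.
by rewrite mulnS numeralD IH /= pm_mulDr mulx1 pm_addC.
Qed.

Lemma numeral_mod (P : preMeadow) (p k : nat) :
  numeral P p = 0 -> numeral P (k %% p) = numeral P k.
Proof.
move=> p0; rewrite {2}(divn_eq k p) numeralD numeralM p0.
by rewrite pm_mulC mul0_numeral add0x.
Qed.

(** * Permutations with a single fixed point *)

Lemma prime_power_le5 (c : nat) :
  (1 < c <= 5)%N -> exists2 q : nat, prime q & q.-nat c.
Proof.
by case: c => [|[|[|[|[|[|c]]]]]] //= _; [exists 2|exists 3|exists 2|exists 5].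
Qed.

(** The orbit of [x0] has [c] elements, where [c] is the order of [s], and avoids
[a]. Unless [c = p], there are two more elements, so that [c] is a power of a
prime [q]; then [s] moves a multiple of [q] points, and it moves [p] points. *)
Lemma perm_order_prime (T : finType) (s : {perm T}) (a x0 : T) (p : nat) :
    prime p -> (p <= 7)%N -> #|T| = p.+1 -> s a = a ->
    (forall x, s x = x -> x = a) -> x0 != a ->
    (forall k, (s ^+ k)%g x0 = x0 -> (s ^+ k = 1)%g) ->
  #[s]%g = p.
Proof.
move=> p_pr p7 cT sa fixa x0a free.
set c := #[s]%g.
have aO : a \notin porbit s x0.
  apply/negP; rewrite porbit_sym => /porbitP[k x0E].
  by move: x0a; rewrite x0E permX iter_fix // eqxx.
have cO : #|porbit s x0| = c.
  apply/eqP; rewrite eqn_dvd; apply/andP; split.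
    by rewrite porbitE; apply: dvdn_orbit.
  by rewrite order_dvdn; apply/eqP/free; rewrite permX iter_porbit.
have c_gt1 : (1 < c)%N.
  rewrite ltn_neqAle order_gt0 andbT; apply/eqP => c1.
  have s1 : s = 1%g by apply/eqP; rewrite -order_eq1 -/c -c1.
  by move: x0a; rewrite (fixa x0) ?eqxx // s1 perm1.
pose B := ~: (a |: porbit s x0).
have cB : (#|B| + c = p)%N.
  apply/eqP; rewrite -(eqn_add2r 1) !addn1 -cT -(cardsC (a |: porbit s x0)).
  by rewrite cardsU1 aO cO add1n addSn addnC.
(* An element of [B] is moved by [s], and within [B]. *)
case: (posnP #|B|) => [B0 | /card_gt0P[y yB]]; first by rewrite -cB B0.
have syB : s y \in B.
  move: yB; rewrite !inE !negb_or => /andP[ya yO]; apply/andP; split.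
    by apply: contraNneq ya => sya; rewrite -(inj_eq (@perm_inj _ s)) sya sa.
  by rewrite porbit_sym -(expg1 s) porbit_perm -porbit_sym.
have B_gt1 : (1 < #|B|)%N.
  apply/card_gt1P; exists (s y), y; split=> //.
  apply: contraTneq yB => /fixa ->.
  by rewrite !inE eqxx.
have c5 : (1 < c <= 5)%N.
  rewrite c_gt1 /= -(leq_add2l 2); apply: leq_trans p7.
  by rewrite -cB leq_add2r.
have [q q_pr qc] := prime_power_le5 c5.
have fixE : 'Fix_([set: T] | 'P)(<[s]>)%g = [set a].
  rewrite setTI afix_cycle ?inE //; apply/setP => x; rewrite in_set1.
  apply/afix1P/eqP => [|->]; [exact: fixa | exact: sa].
have acts : [acts <[s]>, on [set: T] | 'P]%g.
  by apply/actsP => u _ x; rewrite !in_setT.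
(* This makes [p + 1] and [1] congruent modulo [q]. *)
have := pgroup_fix_mod qc acts.
rewrite fixE cardsT cT cards1 => /eqP.
rewrite -(addn0 1%N) -addn1 addnC eqn_modDl mod0n -/(dvdn q p) dvdn_prime2 //.
move=> /eqP qp; have : (q %| c)%N.
  by have [e cE] := p_natP qc; move: c_gt1; rewrite cE; case: e {cE} => // e _;
    rewrite expnS dvdn_mulr.
rewrite qp => /(dvdn_leq (ltnW c_gt1)) pc; apply/eqP; rewrite eqn_leq pc.
by rewrite -cB leq_addl.
Qed.

(** * Common meadows with p + 1 elements *)

(** Apply [perm_order_prime] to the translation by one, carried over to ['I_p.+1]:
its powers are the translations by numerals, so the first numeral to vanish is
its order. *)
Lemma numeral_eq0 (N : commonMeadow) (p k : nat) :
    prime p -> (p <= 7)%N -> has_order p.+1 N ->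
  (numeral N k = 0 <-> p %| k).
Proof.
move=> p_pr p7 [f [g fK gK]].
pose s0 i := g (f i + 1).
have s0_inj : injective s0.
  by move=> i j /(can_inj gK) /add1_inj /(can_inj fK).
pose s := perm s0_inj.
have sX m i : (s ^+ m)%g i = g (f i + numeral N m).
  rewrite permX; elim: m => [|m IH]; first by rewrite /= pm_addx0 fK.
  by rewrite iterS IH permE /s0 gK pm_addA.
have g0a : g 0 != g (cm_a N).
  apply/eqP => /(can_inj gK) a0.
  have triv (x : N) : x = cm_a N by rewrite -(pm_addx0 x) a0 cm_addxa.
  have e0 : ord0 = ord_max :> 'I_p.+1.
    by apply: (can_inj fK); rewrite (triv (f ord0)) (triv (f ord_max)).
  by have /= pE := congr1 (@nat_of_ord _) e0; move: p_pr; rewrite -pE.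
have num0 m : (s ^+ m)%g (g 0) = g 0 -> numeral N m = 0.
  by rewrite sX gK add0x => /(can_inj gK).
have sp : #[s]%g = p.
  apply: (@perm_order_prime _ s (g (cm_a N)) (g 0)) => //.
  - by rewrite card_ord.
  - by rewrite permE /s0 gK pm_addC cm_addxa.
  - move=> i; rewrite permE /s0 => /(congr1 f); rewrite gK => /add1_fixed_eq_a.
    by move=> <-; rewrite fK.
  - move=> m /num0 m0; apply/permP => i.
    by rewrite sX m0 pm_addx0 fK perm1.
rewrite -sp order_dvdn; split=> [k0 | /eqP sk].
  by apply/eqP/permP => i; rewrite sX k0 pm_addx0 fK perm1.
by apply: num0; rewrite sk perm1.
Qed.

Lemma has_order_ext (p : nat) : prime p -> has_order p.+1 (ext_meadow 'F_p).
Proof.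
move=> p_pr; have cE : #|{: option 'F_p}| = p.+1 by rewrite card_option card_Fp.
exists (fun i => enum_val (cast_ord (esym cE) i)).
exists (fun x => cast_ord cE (enum_rank x)) => x.
  by rewrite enum_valK cast_ordKV.
by rewrite cast_ordK enum_rankK.
Qed.

(** The [p] numerals and [a] exhaust [N], and [numeral] turns arithmetic modulo
[p] into the operations of [N]. Inverses need an argument: if [x * y = 1], then
the inverses of [x] and [y] have product [1], so that the inverse of [x] is not
the absorbing [a]; hence it is a numeral, and it is [y] as ['F_p] is a field. *)
Lemma numeral_isomorphism (N : commonMeadow) (p : nat) :
    prime p -> has_order p.+1 N -> (forall k, numeral N k = 0 <-> p %| k) ->
  meadow_isomorphic (ext_meadow 'F_p) N.
Proof.
move=> p_pr [fN [gN fNK gNK]] num0.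
have nump : numeral N p = 0 by apply/num0.
pose h (x : 'F_p) := numeral N x.
have h_nat k : h k%:R%R = numeral N k.
  by rewrite /h val_Fp_nat // numeral_mod.
have hE x : exists2 k, x = k%:R%R & h x = numeral N k.
  by exists x => //; rewrite natr_Zp.
have hD x y : h (x + y)%R = h x + h y.
  have [k -> ->] := hE x; have [l -> ->] := hE y.
  by rewrite -natrD h_nat numeralD.
have hM x y : h (x * y)%R = h x * h y.
  have [k -> ->] := hE x; have [l -> ->] := hE y.
  by rewrite -natrM h_nat numeralM.
have h0 : h 0%R = 0 by rewrite -[0%R]/(0%:R)%R h_nat.
have h1 : h 1%R = 1 by rewrite -[1%R]/(1%:R)%R h_nat /= add0x.
have mul0h x : 0 * h x = 0 by apply: mul0_numeral.
have hN x : h (- x)%R = - h x.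
  by rewrite -[RHS]pm_addx0 -h0 -(subrr x) hD -pm_addA [- _ + _]pm_addC pm_addxN
    mul0h add0x.
have h_eq0 x : h x = 0 -> x = 0%R.
  have [k -> ->] := hE x => /num0 pk.
  by apply/eqP; rewrite -(dvdn_pcharf (pchar_Fp p_pr)).
have a_neq0 : cm_a N <> 0.
  move=> a0; have := cm_addxa (1 : N); rewrite a0 pm_addx0 -h1.
  by move=> /h_eq0 /eqP; rewrite oner_eq0.
have ha x : h x <> cm_a N.
  by move=> /(congr1 (pm_mul 0)); rewrite mul0h mul0_a => /esym.
have h_inj : injective h.
  move=> x y hxy; apply/eqP; rewrite -subr_eq0; apply/eqP/h_eq0.
  by rewrite hD hN hxy pm_addxN.
pose f (x : ext_meadow 'F_p) : N := if x is Some x' then h x' else cm_a N.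
have f_inj : injective f.
  move=> [x|] [y|] //=; first by move/h_inj ->.
    by move/ha.
  by move/esym/ha.
have f_bij : bijective f.
  have gf_inj : injective (gN \o f : option 'F_p -> 'I_p.+1).
    by apply: inj_comp f_inj; apply: can_inj gNK.
  have [|k kK Kk] := inj_card_bij gf_inj.
    by rewrite card_option card_Fp // card_ord.
  exists (k \o gN) => x; first exact: kK.
  by apply: (can_inj gNK); apply: Kk.
have cm_a_mul (x : N) : cm_a N * x = cm_a N by rewrite pm_mulC mulxa.
have cm_a_add (x : N) : cm_a N + x = cm_a N by rewrite pm_addC cm_addxa.
exists f; split=> //; split; first split=> //=.
- by move=> [x|] [y|] /=; rewrite ?cm_addxa ?cm_a_add.
- by move=> [x|] [y|] /=; rewrite ?mulxa ?cm_a_mul.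
- by move=> [x|] /=; rewrite ?oppa.
move=> [x|] /=; last by rewrite inva.
case: (eqVneq x 0%R) => [->|x0]; first by rewrite h0 cm_inv0.
have hxV : h x * h x^-1%R = 1 by rewrite -hM divff.
have inv_a : cm_inv (h x) <> cm_a N.
  move=> xa; have := inv1 N; rewrite -{1}hxV cm_invM xa cm_a_mul -h1 => /esym.
  exact: ha.
have [k _ kK] := f_bij.
have := kK (cm_inv (h x)); case: (k _) => [y|] /= hy; last by case: inv_a.
have := cm_mulxV (h x); rewrite -hy mul0h pm_addx0 -hM -h1 => /h_inj xy.
by rewrite -[y](mulKf x0) xy mulr1.
Qed.

Theorem corollary3p14 (n : nat) (hn : n \in [:: 3; 4; 6; 8]) :
  exists M : commonMeadow,
    has_order n M /\
    forall N : commonMeadow, has_order n N -> meadow_isomorphic M N.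
Proof.
have [p [p_pr p7 ->]] : exists p, [/\ prime p, (p <= 7)%N & n = p.+1].
  move: hn; rewrite !inE => /or4P[] /eqP ->.
  - by exists 2.
  - by exists 3.
  - by exists 5.
  - by exists 7.
exists (ext_meadow 'F_p); split; first exact: has_order_ext.
by move=> N oN; apply: numeral_isomorphism => // k; apply: numeral_eq0.
Qed.
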